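(* Let a document of tokens be generated by a token-exchangeable topic model on $\widetilde{\mathcal V}$, i.e. given $\boldsymbol\theta$ the tokens $v_1,v_2,\dots$ are i.i.d. draws from $\pi_{\boldsymbol\theta}$, and suppose $0<e(\boldsymbol\theta)<1$. Let $\sigma_2(\boldsymbol\theta)=\sum_{w\in\mathcal V}\pi_{\boldsymbol\theta}(w)\,\mathrm{syl}(w)^2$. Then, conditionally on $\boldsymbol\theta$, as $N\to\infty$, $$\sqrt N\,\bigl(\mathrm{FKGL}_N-\Phi(\boldsymbol\theta)\bigr)\Rightarrow\mathcal N\bigl(0,\tau^2(\boldsymbol\theta)\bigr)$$ in distribution, where, with $e=e(\boldsymbol\theta)$, $\sigma=\sigma(\boldsymbol\theta)$, $\sigma_2=\sigma_2(\boldsymbol\theta)$, $$\tau^2=g_e^2\,e(1-e)-2\,g_eg_\sigma\,e\,\sigma+g_\sigma^2(\sigma_2-\sigma^2),\qquad g_e=-\frac{a}{e^2}+\frac{b\,\sigma}{(1-e)^2},\qquad g_\sigma=\frac{b}{1-e}.$$ In particular $\mathrm{FKGL}_N-\Phi(\boldsymbol\theta)=O_p(N^{-1/2})$.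
   Context: $\mathcal V$ is a finite word vocabulary, $\dashv$ is a sentence-boundary token, and $\widetilde{\mathcal V}=\mathcal V\cup\{\dashv\}$. $\mathrm{syl}:\mathcal V\to[1,s_{\max}]$ is a fixed bounded real-valued syllable count, extended by $\mathrm{syl}(\dashv)=0$. $\Delta^{m-1}$ is the probability simplex in $\mathbb R^m$. A token-exchangeable topic model consists of a document-level variable $\boldsymbol\theta\in\Delta^{K-1}$ with some prior and a map $\boldsymbol\theta\mapsto\pi_{\boldsymbol\theta}\in\Delta^{|\widetilde{\mathcal V}|-1}$ such that, given $\boldsymbol\theta$, the tokens are i.i.d. from $\pi_{\boldsymbol\theta}$. Define $e(\boldsymbol\theta)=\pi_{\boldsymbol\theta}(\dashv)$, $\sigma(\boldsymbol\theta)=\sum_{w\in\mathcal V}\pi_{\boldsymbol\theta}(w)\,\mathrm{syl}(w)$, and $\Phi(\boldsymbol\theta)=a\frac{1-e(\boldsymbol\theta)}{e(\boldsymbol\theta)}+b\frac{\sigma(\boldsymbol\theta)}{1-e(\boldsymbol\theta)}+c$. Let $S_N=\sum_{n\le N}\mathbf 1[v_n=\dashv]$, $W_N=N-S_N$, $Y_N=\sum_{n\le N}\mathrm{syl}(v_n)$, and $\mathrm{FKGL}_N=a\,W_N/S_N+b\,Y_N/W_N+c$, with an arbitrary fixed value assigned when $S_N=0$ or $W_N=0$. The coefficients $(a,b,c)$ are fixed: $(0.39,11.8,-15.59)$ (Flesch–Kincaid Grade Level) or $(-1.015,-84.6,206.835)$ (Flesch Reading Ease). $\mathcal N(0,0)$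 denotes the point mass at $0$. $X_N=O_p(N^{-1/2})$ means $\sqrt N X_N$ is bounded in probability (tight). *)

(* Defs.v *)
From HB Require Import structures.
From mathcomp Require Import all_boot all_order all_algebra.
From mathcomp Require Import all_classical all_reals all_analysis.

Set Implicit Arguments.
Unset Strict Implicit.
Unset Printing Implicit Defensive.

Import Order.TTheory GRing.Theory Num.Theory.
Import numFieldNormedType.Exports.

Local Open Scope classical_set_scope.
Local Open Scope ring_scope.

Definition simplex (R : realType) (I : finType) : set (I -> R) :=
  [set p | (forall i, 0 <= p i) /\ \sum_i p i = 1].

(* The letters live in a finite type with its discrete sigma-algebra, so the
   events [X j \in B j] range over arbitrary sets [B j]. *)
Definition mutually_independent (R : realType) d (Omega : measurableType d)
    (P : probability Omega R) (T : finType) (X : nat -> Omega -> T) : Prop :=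
  forall (J : seq nat) (B : nat -> set T), uniq J ->
    P (\bigcap_(j in [set` J]) (X j @^-1` B j)) =
    (\prod_(j <- J) P (X j @^-1` B j))%E.

Definition iid_from (R : realType) d (Omega : measurableType d)
    (P : probability Omega R) (T : finType) (X : nat -> Omega -> T)
    (p : T -> R) : Prop :=
  mutually_independent P X /\
  forall n t, P (X n @^-1` [set t]) = (p t)%:E.

(* The extended vocabulary is [option V], with [None] the sentence-boundary
   token.  [doc_law theta] is the conditional law of the document given the
   document-level variable theta, so that the joint law of (theta, document)
   is the composition of [prior] with the kernel [doc_law].  The total
   functions [token_prob] and [doc_law] are only constrained on the simplex,
   which carries the prior.  The tokens v_1, v_2, ... are [token 0],
   [token 1], ... *)
Record topic_model (R : realType) (V : finType) (K : nat)
    d (Omega : measurableType d) := TopicModel {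
  prior : probability (K.-tuple R) R ;
  prior_simplex : prior [set theta | simplex (tnth theta)] = 1%E ;
  token_prob : K.-tuple R -> option V -> R ;
  token_prob_simplex : forall theta,
    simplex (tnth theta) -> simplex (token_prob theta) ;
  doc_law : K.-tuple R -> probability Omega R ;
  measurable_doc_law :
    measurable_fun setT (doc_law : K.-tuple R -> pprobability Omega R) ;
  token : nat -> Omega -> option V ;
  measurable_token : forall n t, measurable (token n @^-1` [set t]) ;
  token_iid : forall theta, simplex (tnth theta) ->
    iid_from (doc_law theta) token (token_prob theta) }.

Section Readability.
Variables (R : realType) (V : finType).
Implicit Types (a b c : R) (syl : V -> R) (p : option V -> R).

Definition readability_coefficients a b c : Prop :=
  (a, b, c) = (39 / 100, 11 + 8 / 10, - (15 + 59 / 100)) \/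
  (a, b, c) = (- (1 + 15 / 1000), - (84 + 6 / 10), 206 + 835 / 1000).

Definition syl_ext syl (t : option V) : R := if t is Some w then syl w else 0.

Definition eos p : R := p None.
Definition sigma syl p : R := \sum_(w : V) p (Some w) * syl w.
Definition sigma2 syl p : R := \sum_(w : V) p (Some w) * syl w ^+ 2.

Definition Phi a b c syl p : R :=
  a * ((1 - eos p) / eos p) + b * (sigma syl p / (1 - eos p)) + c.

Definition g_e a b syl p : R :=
  - (a / eos p ^+ 2) + b * sigma syl p / (1 - eos p) ^+ 2.
Definition g_sigma b p : R := b / (1 - eos p).

Definition tau2 a b syl p : R :=
  g_e a b syl p ^+ 2 * (eos p * (1 - eos p))
  - 2 * g_e a b syl p * g_sigma b p * eos p * sigma syl p
  + g_sigma b p ^+ 2 * (sigma2 syl p - sigma syl p ^+ 2).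

Section Counts.
Variables (Omega : Type) (v : nat -> Omega -> option V).

Definition sentences (N : nat) (x : Omega) : nat :=
  (\sum_(n < N) (v n x == None))%N.
Definition words (N : nat) (x : Omega) : nat := (N - sentences N x)%N.
Definition syllables syl (N : nat) (x : Omega) : R :=
  \sum_(n < N) syl_ext syl (v n x).

Definition FKGL a b c syl (dflt : R) (N : nat) (x : Omega) : R :=
  if (sentences N x == 0%N) || (words N x == 0%N) then dflt
  else a * ((words N x)%:R / (sentences N x)%:R)
       + b * (syllables syl N x / (words N x)%:R) + c.
End Counts.
End Readability.

(* Centred normal law of variance [s2 >= 0].  [normal_prob] takes the standard
   deviation, and at standard deviation 0 it is not the point mass. *)
Definition centred_normal (R : realType) (s2 : R) :
    probability (measurableTypeR R) R :=
  if s2 == 0 then (\d_(0 : measurableTypeR R) : probability (measurableTypeR R) R)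
  else (normal_prob 0 (Num.sqrt s2) : probability (measurableTypeR R) R).

Definition cvg_in_distribution (R : realType) d (Omega : measurableType d)
    (P : probability Omega R) (X : nat -> Omega -> R)
    (mu : probability (measurableTypeR R) R) : Prop :=
  (forall n, measurable_fun setT (X n)) /\
  forall f : R -> R, continuous f -> (exists C : R, forall y, `|f y| <= C) ->
    (fun n => \int[P]_x (f (X n x))%:E)%E @ \oo --> (\int[mu]_y (f y)%:E)%E.

Definition bounded_in_probability (R : realType) d (Omega : measurableType d)
    (P : probability Omega R) (X : nat -> Omega -> R) : Prop :=
  (forall n, measurable_fun setT (X n)) /\
  forall eps : R, 0 < eps -> exists M : R,
    forall n, (P [set x | (M < `|X n x|)%R] <= eps%:E)%E.

(* Main.v *)
Require Import Defs.
From HB Require Import structures.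
From mathcomp Require Import all_boot all_order all_algebra.
From mathcomp Require Import all_classical all_reals all_analysis.
From mathcomp Require Import measurable_realfun ring lra.

Set Implicit Arguments.
Unset Strict Implicit.
Unset Printing Implicit Defensive.

Import Order.TTheory GRing.Theory Num.Theory.
Import numFieldNormedType.Exports.

Local Open Scope classical_set_scope.
Local Open Scope ring_scope.

(* Stein's method followed by the delta method.  The first N tokens follow a
   finite product law, so every expectation is a finite sum.  Let W be the
   normalised sum of N i.i.d. centred scores with variance tau^2.  Resampling
   one letter at a time gives E[W f(W)] - tau^2 E[f'(W)] -> 0 as soon as f' is
   uniformly continuous.  If h is continuous with compact support and has mean
   zero under N(0, tau^2), then tau^2 f' - x f = tau^2 h has a C^1 solution
   which is again compactly supported, so E[h(W)] -> 0 without any tail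
   estimate; with tightness, such h determine convergence in distribution.
   Finally sqrt N (FKGL_N - Phi) differs from W (for the score
   g_e (1[v = eos] - e) + g_sigma (syl v - sigma)) by a remainder which, off an
   event controlled by Chebyshev, is quadratic in the empirical deviations and
   hence has mean O(N^(-1/2)). *)

(** * Product laws and Stein's identity *)

(** The distance equation places [xi] between [y] and [y + h] without a case split on the sign of
    [h], since resampled increments may have either sign. *)
Lemma derive_increment (R : realType) (f g : R -> R) (y h : R) :
  (forall z : R, is_derive z 1 f (g z)) ->
  exists xi, `|xi - y| + `|xi - (y + h)| = `|h| /\ f (y + h) - f y = g xi * h.
Proof.
move=> fg.
have cf : continuous f.
  by move=> z; apply/differentiable_continuous/derivable1_diffP; case: (fg z).
have cfw A : {within A, continuous f} by exact: continuous_subspaceT.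
have [h0|h0] := leP 0 h.
  have [xi] := MVT_segment (ltac:(by rewrite lerDl) : y <= y + h)
    (fun z _ => fg z) (cfw _).
  rewrite in_itv /= => /andP[y1 y2] E; exists xi; split; last by rewrite E; ring.
  by rewrite ger0_norm ?subr_ge0// ler0_norm ?subr_le0// ger0_norm//; ring.
have [xi] := MVT_segment (ltac:(by rewrite gerDl ltW) : y + h <= y)
  (fun z _ => fg z) (cfw _).
rewrite in_itv /= => /andP[y1 y2] E; exists xi; split.
  by rewrite ler0_norm ?subr_le0// ger0_norm ?subr_ge0// ltr0_norm//; ring.
by apply: oppr_inj; rewrite opprB E; ring.
Qed.

Section ProductLaw.
Variables (R : realType) (T : finType) (p : T -> R).
Hypothesis p_ge0 : forall u, 0 <= p u.
Hypothesis p_sum1 : \sum_u p u = 1.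

Definition weight N (t : {ffun 'I_N -> T}) : R := \prod_i p (t i).

Definition mean N (G : {ffun 'I_N -> T} -> R) : R := \sum_t weight t * G t.

Lemma weight_ge0 N (t : {ffun 'I_N -> T}) : 0 <= weight t.
Proof. exact: prodr_ge0. Qed.

Lemma weight_sum1 N : \sum_(t : {ffun 'I_N -> T}) weight t = 1.
Proof.
rewrite /weight -(bigA_distr_bigA (fun _ : 'I_N => p)) /=.
by rewrite big1 // => i _.
Qed.

Lemma eq_mean N (F G : {ffun 'I_N -> T} -> R) : F =1 G -> mean F = mean G.
Proof. by move=> FG; apply: eq_bigr => t _; rewrite FG. Qed.

Lemma mean_cst N (c : R) : mean (fun _ : {ffun 'I_N -> T} => c) = c.
Proof. by rewrite /mean -mulr_suml weight_sum1 mul1r. Qed.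

Lemma meanD N (F G : {ffun 'I_N -> T} -> R) :
  mean (fun t => F t + G t) = mean F + mean G.
Proof. by rewrite /mean -big_split; apply: eq_bigr => t _; rewrite mulrDr. Qed.

Lemma meanB N (F G : {ffun 'I_N -> T} -> R) :
  mean (fun t => F t - G t) = mean F - mean G.
Proof. by rewrite /mean -sumrB; apply: eq_bigr => t _; rewrite mulrBr. Qed.

Lemma meanZ N (c : R) (F : {ffun 'I_N -> T} -> R) :
  mean (fun t => c * F t) = c * mean F.
Proof. by rewrite /mean mulr_sumr; apply: eq_bigr => t _; rewrite mulrCA. Qed.

Lemma mean_sum N (I : finType) (F : I -> {ffun 'I_N -> T} -> R) :
  mean (fun t => \sum_i F i t) = \sum_i mean (F i).
Proof.
by rewrite /mean exchange_big; apply: eq_bigr => t _; rewrite mulr_sumr.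
Qed.

Lemma le_mean N (F G : {ffun 'I_N -> T} -> R) :
  (forall t, F t <= G t) -> mean F <= mean G.
Proof. by move=> FG; apply: ler_sum => t _; rewrite ler_wpM2l ?weight_ge0. Qed.

Lemma ler_norm_mean N (F : {ffun 'I_N -> T} -> R) :
  `|mean F| <= mean (fun t => `|F t|).
Proof.
rewrite /mean (le_trans (ler_norm_sum _ _ _)) //; apply: ler_sum => t _.
by rewrite normrM (ger0_norm (weight_ge0 t)).
Qed.

Definition replace N (t : {ffun 'I_N -> T}) (i : 'I_N) (u : T) :
  {ffun 'I_N -> T} := [ffun j => if j == i then u else t j].

Lemma mean_resample N (i : 'I_N) (G : {ffun 'I_N -> T} -> R) :
  mean G = mean (fun t => \sum_u p u * G (replace t i u)).
Proof.
rewrite /mean; under [RHS]eq_bigr do rewrite mulr_sumr.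
rewrite pair_bigA /=.
(* Swapping the [i]-th letter with the fresh one preserves the product
   weight of the pair. *)
pose s (z : {ffun 'I_N -> T} * T) := (replace z.1 i z.2, z.1 i).
have sK : involutive s.
  move=> [t u]; rewrite /s /=; congr pair; last by rewrite ffunE eqxx.
  by apply/ffunP => j; rewrite !ffunE; case: eqP => [->|].
rewrite (reindex_inj (inv_inj sK)) /=.
have E (z : {ffun 'I_N -> T} * T) :
    weight (replace z.1 i z.2) *
      (p (z.1 i) * G (replace (replace z.1 i z.2) i (z.1 i)))
    = (weight z.1 * G z.1) * p z.2.
  have -> : replace (replace z.1 i z.2) i (z.1 i) = z.1.
    by have /(congr1 fst) := sK z.
  rewrite /weight (bigD1 i) //= [in RHS](bigD1 i) //= ffunE eqxx.
  under eq_bigr => j ji do rewrite ffunE (negbTE ji).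
  by ring.
under [RHS]eq_bigr do rewrite E.
rewrite -(pair_bigA _ (fun t u => (weight t * G t) * p u)) /=.
by apply: eq_bigr => t _; rewrite -mulr_sumr p_sum1 mulr1.
Qed.

Definition total (x : T -> R) N (t : {ffun 'I_N -> T}) : R := \sum_i x (t i).

Lemma total_replace x N (t : {ffun 'I_N -> T}) i u :
  total x (replace t i u) = total x t - x (t i) + x u.
Proof.
rewrite /total (bigD1 i) //= [in RHS](bigD1 i) //= ffunE eqxx.
under eq_bigr => j ji do rewrite ffunE (negbTE ji).
by ring.
Qed.

(** The [i]-th letter is resampled in the [i]-th summand of the total. The rest,
    [total x t - x (t i)], does not involve that letter, so the fresh letter [u] is independent of
    it; the variance and Stein's identity both start here. *)
Lemma mean_total x N (F : R -> R) :
  mean (fun t : {ffun 'I_N -> T} => total x t * F (total x t)) =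
  \sum_i mean (fun t : {ffun 'I_N -> T} =>
     \sum_u p u * (x u * F (total x t - x (t i) + x u))).
Proof.
rewrite (eq_mean (fun t => mulr_suml _ _ _ _)) mean_sum.
apply: eq_bigr => i _; rewrite (mean_resample i); apply: eq_mean => t.
by apply: eq_bigr => u _; rewrite total_replace ffunE eqxx.
Qed.

Section Centred.
Variable x : T -> R.
Hypothesis x_centred : \sum_u p u * x u = 0.

Definition second_moment : R := \sum_u p u * x u ^+ 2.

Lemma sum_centred (c : R) : \sum_u c * (p u * x u) = 0.
Proof. by rewrite -mulr_sumr x_centred mulr0. Qed.

Lemma second_moment_ge0 : 0 <= second_moment.
Proof. by apply: sumr_ge0 => u _; rewrite mulr_ge0 ?sqr_ge0. Qed.

Lemma mean_total_sqr N :
  mean (fun t : {ffun 'I_N -> T} => total x t ^+ 2) = N%:R * second_moment.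
Proof.
under eq_mean do rewrite expr2; rewrite (mean_total _ _ id).
rewrite -[N in RHS]card_ord mulr_natl -sumr_const; apply: eq_bigr => i _.
rewrite -[RHS](mean_cst N); apply: eq_mean => t.
(* The leave-one-out part multiplies a centred letter and drops out, leaving only the square of
   [x u]. *)
rewrite /second_moment -[RHS]add0r -[X in _ = X + _](sum_centred (total x t - x (t i))).
rewrite -big_split; apply: eq_bigr => u _ /=; ring.
Qed.

(** Here [k] is the inverse square root of [N]. Resampling produces increments of [f] over steps
    [k * x u]; the mean value theorem turns them into values of [g] at points within [2 * k * M] of
    the normalised sum, and replacing these by [g] at the sum itself costs at most [eta]. *)
Lemma stein_bound N (f g : R -> R) (k M eta delta : R) :
  (forall y : R, is_derive y 1 f (g y)) ->
  (forall y z, `|y - z| <= delta -> `|g y - g z| <= eta) ->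
  (forall u, `|x u| <= M) ->
  0 <= k -> k ^+ 2 * N%:R = 1 -> 2 * k * M <= delta ->
  `|mean (fun t : {ffun 'I_N -> T} => k * total x t * f (k * total x t))
    - second_moment * mean (fun t : {ffun 'I_N -> T} => g (k * total x t))|
  <= second_moment * eta.
Proof.
move=> fg gmod xM k0 kN kM.
(* [z] is the full normalised sum, [s] the score of the letter removed and [u] the fresh letter. *)
have step (s z : R) (u : T) : `|s| <= M ->
    `|k * x u * (f (z - k * s + k * x u) - f (z - k * s))
      - k ^+ 2 * x u ^+ 2 * g z| <= k ^+ 2 * x u ^+ 2 * eta.
  move=> sM; have [xi [xiE ->]] := derive_increment (z - k * s) (k * x u) fg.
  rewrite (_ : _ - _ = k ^+ 2 * x u ^+ 2 * (g xi - g z)); last by ring.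
  have c0 : 0 <= k ^+ 2 * x u ^+ 2 by rewrite -exprMn sqr_ge0.
  rewrite normrM (ger0_norm c0) ler_wpM2l//; apply: gmod; apply: le_trans kM.
  have a1 : `|k * x u| <= k * M by rewrite normrM ger0_norm// ler_wpM2l.
  have a2 : `|k * s| <= k * M by rewrite normrM ger0_norm// ler_wpM2l.
  have a3 : `|xi - z| <= `|xi - (z - k * s)| + `|k * s|.
    by rewrite (_ : xi - z = xi - (z - k * s) - k * s) ?ler_normB//; ring.
  have a4 : 0 <= `|xi - (z - k * s + k * x u)| by [].
  by lra.
have -> : mean (fun t : {ffun 'I_N -> T} =>
      k * total x t * f (k * total x t)) =
    \sum_i mean (fun t : {ffun 'I_N -> T} => \sum_u p u *
      (k * x u * (f (k * total x t - k * x (t i) + k * x u)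
                  - f (k * total x t - k * x (t i))))).
  under eq_mean do rewrite -mulrA.
  rewrite meanZ (mean_total _ _ (fun s => f (k * s))) mulr_sumr.
  apply: eq_bigr => i _; rewrite -meanZ; apply: eq_mean => t.
  (* Centring lets [f] at the leave-one-out sum be subtracted for free, which creates the
     increment. *)
  rewrite -[RHS]addr0.
  rewrite -[X in _ = _ + X](sum_centred (k * f (k * total x t - k * x (t i)))).
  rewrite [LHS]mulr_sumr -big_split; apply: eq_bigr => u _ /=.
  rewrite (_ : k * (_ - _ + _) = k * total x t - k * x (t i) + k * x u); last first.
    by ring.
  by ring.
(* Since [k ^+ 2 * N%:R = 1], a single mean is spread over [N] equal summands and the comparison can
   be made letter by letter. *)
have E2 (G : {ffun 'I_N -> T} -> R) : second_moment * mean G =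
    \sum_(i < N) mean (fun t : {ffun 'I_N -> T} => \sum_u p u *
      (k ^+ 2 * x u ^+ 2 * G t)).
  rewrite sumr_const card_ord -mulr_natl.
  rewrite [X in _ = _ * X](_ : _ = k ^+ 2 * second_moment * mean G).
    transitivity (k ^+ 2 * N%:R * (second_moment * mean G)); first by rewrite kN mul1r.
    by ring.
  rewrite -meanZ; apply: eq_mean => t.
  by rewrite /second_moment mulr_sumr mulr_suml; apply: eq_bigr => u _; ring.
have -> : second_moment * eta = second_moment * mean (fun _ : {ffun 'I_N -> T} => eta).
  by rewrite mean_cst.
rewrite !E2 -sumrB (le_trans (ler_norm_sum _ _ _))//; apply: ler_sum => i _.
rewrite -meanB (le_trans (ler_norm_mean _))//; apply: le_mean => t.
rewrite -sumrB (le_trans (ler_norm_sum _ _ _))//; apply: ler_sum => u _.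
by rewrite -mulrBr normrM ger0_norm// ler_wpM2l// step.
Qed.

End Centred.
End ProductLaw.

(** * Stein's equation *)

(** On a segment this is the Heine-Cantor argument. The segment exceeds the support by 1 and [delta]
    is at most 1, so when [y] is outside the segment both [y] and [z] are outside the support. *)
Lemma compact_support_unif_continuous (R : realType) (f : R -> R) (A : R) :
  continuous f -> (forall x, A < `|x| -> f x = 0) ->
  forall eta, 0 < eta -> exists2 delta, 0 < delta &
    forall y z, `|y - z| <= delta -> `|f y - f z| <= eta.
Proof.
move=> cf f0 eta eta0; pose B := `|A| + 1.
pose Q (d x : R) := forall z, `|x - z| < d -> `|f x - f z| <= eta.
have cov : \forall d \near (0 : R)^'+, `[- B, B] `<=` Q d.
  have /compact_near_coveringP := @segment_compact R (- B) B.
  apply => x _; have /cvgrPdist_lt/(_ (eta / 2)) := cf x.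
  rewrite divr_gt0// => /(_ erefl)/nbhs_ballP[e /= e0 He].
  exists (ball x (e / 2), [set d | d < e / 2]) => /=.
    by split; [apply: nbhsx_ballx|apply: nbhs_right_lt]; rewrite divr_gt0.
  move=> [y d] /= [xy de] z yz; rewrite /ball /= in xy He.
  have h1 : `|f x - f y| < eta / 2 by apply: He; rewrite /=; lra.
  have h2 : `|f x - f z| < eta / 2.
    apply: He; rewrite /= (_ : x - z = (x - y) + (y - z)); last by ring.
    by rewrite (le_lt_trans (ler_normD _ _))//; lra.
  rewrite (_ : f y - f z = (f x - f z) - (f x - f y)); last by ring.
  by rewrite (le_trans (ler_normB _ _))//; lra.
have /filter_ex[d [d0 Hd]] : \forall d \near (0 : R)^'+, 0 < d /\ `[- B, B] `<=` Q d.
  by apply: filterI => //; exact: nbhs_right_gt.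
exists (Num.min (d / 2) 1); first by rewrite lt_min ltr01 divr_gt0.
move=> y z; rewrite le_min => /andP[yz1 yz2].
have [yB|yB] := leP `|y| B.
  by apply: Hd; [rewrite /= in_itv /= -ler_norml|lra].
have AA := ler_norm A.
rewrite !f0 ?subr0 ?normr0 ?ltW//; rewrite /B in yB; last by lra.
have := lerB_dist y (y - z).
by rewrite (_ : y - (y - z) = z); [lra|ring].
Qed.

Section NormalIntegral.
Variables (R : realType) (s : R).
Hypothesis s0 : s != 0.
Local Notation mu := (@lebesgue_measure R).

(** The Radon-Nikodym derivative of the normal law agrees almost everywhere with [normal_pdf],
    because both have the same integral over every measurable set. *)
Lemma integral_normal_prob (f : R -> \bar R) :
  (normal_prob 0 s : probability (measurableTypeR R) R).-integrable setT f ->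
  (\int[normal_prob 0 s]_x f x = \int[mu]_x (f x * (normal_pdf 0 s x)%:E))%E.
Proof.
move=> intf; have mf := measurable_int _ intf.
rewrite -(Radon_Nikodym_change_of_variables (normal_prob_dominates 0 s))//=.
apply: ae_eq_integral => //.
- apply: emeasurable_funM => //; apply: (measurable_int mu).
  by apply: Radon_Nikodym_integrable; exact: normal_prob_dominates.
- apply: emeasurable_funM; first exact: mf.
  by apply/measurable_EFinP; exact: measurable_normal_pdf.
- apply: ae_eqe_mul2l => /=.
  rewrite Radon_NikodymE//=; first exact: normal_prob_dominates.
  move=> dom; case: cid => /= h [h1 h2 h3].
  apply: integral_ae_eq => //=.
  + by apply/measurable_EFinP; exact: measurable_normal_pdf.
  + by move=> E _ mE; rewrite -h3.
Qed.

End NormalIntegral.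

Lemma is_derive_gauss_inv (R : realType) (k x : R) :
  is_derive x 1 (fun y : R => expR (k * y ^+ 2)) (2 * k * x * expR (k * x ^+ 2)).
Proof.
have dq : is_derive x 1 (fun y : R => k * y ^+ 2) (2 * k * x).
  rewrite (_ : (fun y : R => _) = k \*: (id ^+ 2)); last first.
    by apply/funext => y; rewrite /= fctE expr2.
  apply: is_derive_eq; rewrite /= expr1 /GRing.scale /=; ring.
rewrite mulrC.
exact: (@is_derive1_comp _ expR (fun y => k * y ^+ 2) _ _ _ (is_derive_expR _) dq).
Qed.

Lemma bounded_integrable d (T : measurableType d) (R : realType)
    (P : probability T R) (f : T -> R) (C : R) :
  measurable_fun setT f -> (forall x, `|f x| <= C) ->
  P.-integrable setT (EFin \o f).
Proof.
move=> mf fC; apply: measurable_bounded_integrable => //.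
  by rewrite [X in (X < _)%E](@probability_setT _ _ _ P) ltry.
exists C; split; first exact: num_real.
by move=> y Cy x _; apply: le_trans (fC x) _; exact: ltW.
Qed.

Lemma compact_support_bounded (R : realType) (f : R -> R) (A : R) :
  continuous f -> (forall x, A < `|x| -> f x = 0) ->
  exists C : R, forall x, `|f x| <= C.
Proof.
move=> cf f0.
have AA : - `|A| <= `|A| by rewrite ge0_cp.
have [|c _ Hc] := @EVT_max R (fun x => `|f x|) (- `|A|) `|A| AA.
  by apply: continuous_subspaceT => x; apply: cvg_norm; exact: cf.
exists `|f c| => x; have [xA|xA] := leP `|x| `|A|.
  by apply: Hc; rewrite in_itv /= -ler_norml.
by rewrite f0 ?normr0// (le_lt_trans (ler_norm A)).
Qed.

(* The solution is [f x = (\int_{t <= x} h t * normal_pdf t) / normal_pdf x];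
   the mean zero condition is what makes it vanish to the right of the
   support of [h]. *)
Lemma stein_equation (R : realType) (s A : R) (h : R -> R) :
  s != 0 -> continuous h -> (forall x, A < `|x| -> h x = 0) ->
  (\int[normal_prob 0 s]_x (h x)%:E = 0)%E ->
  exists f g : R -> R, [/\ forall x : R, is_derive x 1 f (g x), continuous g,
    forall x, A < `|x| -> g x = 0 &
    forall x, s ^+ 2 * h x = s ^+ 2 * g x - x * f x].
Proof.
move=> s0 ch h0 inth.
have [C hC] := compact_support_bounded ch h0.
pose q := normal_pdf 0 s; pose hq t := h t * q t.
have chq : continuous hq.
  by move=> x; apply: cvgM; [exact: ch|exact: continuous_normal_pdf].
have ihq : (@lebesgue_measure R).-integrable setT (EFin \o hq).
  apply: (@le_integrable _ (measurableTypeR R) R lebesgue_measure setT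
    measurableT _ (fun x => (C%:E * (q x)%:E)%E)) => //.
  - by apply/measurable_EFinP; exact: continuous_measurable_fun.
  - move=> x _; rewrite /= lee_fin normrM [leRHS]ger0_norm.
      by rewrite [X in _ * X]ger0_norm ?normal_pdf_ge0// ler_wpM2r ?normal_pdf_ge0.
    by rewrite mulr_ge0 ?normal_pdf_ge0// (le_trans _ (hC 0)).
  - by apply: integrableZl => //; exact: integrable_normal_pdf.
have inthq : \int[@lebesgue_measure R]_x hq x = 0.
  rewrite /Rintegral -[0]/(fine 0) -inth integral_normal_prob//.
  apply: (@bounded_integrable _ _ _
    (normal_prob 0 s : probability (measurableTypeR R) R) h C) => //.
  exact: continuous_measurable_fun.
pose F x := \int[@lebesgue_measure R]_(t in `]-oo, x]) hq t.
have dF (x : R) : is_derive x 1 F (hq x).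
  have [|||d1 <-] := @continuous_FTC1 R hq -oo%O x (x + 1) _ _ _ (chq x).
  - by rewrite ltrDl.
  - exact: integrableS ihq.
  - by rewrite ltNyr.
  by rewrite derive1E; exact: DeriveDef.
(* To the right of the support the half-line integral is already the full integral, which is zero;
   to the left the integrand vanishes. *)
have F0 x : A < `|x| -> F x = 0.
  move=> Ax; rewrite /F Rintegral_mkcond; have [x0|x0] := leP 0 x.
    rewrite -[RHS]inthq; apply: eq_Rintegral => t _; rewrite patchE.
    case: ifPn => // /negP; rewrite inE /= in_itv /= => /negP; rewrite -ltNge => xt.
    by rewrite /hq h0 ?mul0r// (lt_trans Ax)// !ger0_norm// (le_trans x0)// ltW.
  transitivity (\int[@lebesgue_measure R]_(t in setT) (0 : R)); last first.
    by rewrite Rintegral_cst// mul0r.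
  apply: eq_Rintegral => t _; rewrite patchE.
  case: ifPn => //; rewrite inE /= in_itv /= => tx.
  rewrite /hq h0 ?mul0r// (lt_le_trans Ax)// !ltr0_norm ?lerN2//.
  exact: le_lt_trans x0.
(* [E] is the reciprocal of the density [q] in closed form, which is easy to differentiate. *)
pose k := (2 * s ^+ 2)^-1; pose E (x : R) := expR (k * x ^+ 2) / normal_peak s.
have peak0 : normal_peak s != 0 by rewrite gt_eqF// normal_peak_gt0.
have qE x : q x * E x = 1.
  rewrite /q normal_pdfE// /normal_fun /E subr0.
  rewrite [expR _ / _]mulrC mulrACA divff// mul1r -expRD.
  suff -> : - x ^+ 2 / (s ^+ 2 *+ 2) + k * x ^+ 2 = 0 by rewrite expR0.
  by rewrite /k -mulr_natl; field.
(* [g] is Stein's equation solved for the derivative of [f], so its continuity follows from that of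
   [h] and [f]. *)
pose f x := F x * E x; pose g x := h x + (s ^+ 2)^-1 * (x * f x).
have df (x : R) : is_derive x 1 f (g x).
  have dE : is_derive x 1 E (x / s ^+ 2 * E x).
    rewrite (_ : E = (normal_peak s)^-1 \*: (fun y : R => expR (k * y ^+ 2))).
      apply: (is_derive_eq (is_deriveZ _ (is_derive_gauss_inv k x))).
      rewrite /= /GRing.scale /=; set e := expR _; rewrite /k; field.
      by rewrite s0 peak0.
    by apply/funext => y; rewrite /E mulrC.
  apply: (is_derive_eq (is_deriveM (dF x) dE)).
  rewrite /g /f /hq /GRing.scale /=.
  rewrite (_ : E x * (h x * q x) = h x * (q x * E x)); last by ring.
  by rewrite qE; ring.
have f0 x : A < `|x| -> f x = 0 by move=> /F0; rewrite /f => ->; rewrite mul0r.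
exists f, g; split=> // [x|x Ax|x].
- apply: cvgD; first exact: ch.
  apply: cvgM; first exact: cvg_cst.
  apply: cvgM; first exact: cvg_id.
  by apply/differentiable_continuous/derivable1_diffP; case: (df x).
- by rewrite /g h0// f0// !mulr0 addr0.
- by rewrite /g mulrDr mulVKf ?expf_neq0//; ring.
Qed.

(** * Convergence in distribution *)

Section WeakConvergence.
Variable R : realType.

Definition cutoff (M x : R) : R := Num.min 1 (Num.max 0 (M + 1 - `|x|)).

Lemma cutoff_ge0 M x : 0 <= cutoff M x.
Proof. by rewrite /cutoff le_min ler01 le_max lexx. Qed.

Lemma cutoff_le1 M x : cutoff M x <= 1.
Proof. by rewrite /cutoff ge_min lexx. Qed.

Lemma cutoff_eq1 M x : `|x| <= M -> cutoff M x = 1.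
Proof.
move=> xM; rewrite /cutoff; apply/min_idPl; rewrite le_max; apply/orP; right.
by lra.
Qed.

Lemma cutoff_eq0 M x : M + 1 < `|x| -> cutoff M x = 0.
Proof.
move=> xM; rewrite /cutoff; have /max_idPl -> : M + 1 - `|x| <= 0 by lra.
by apply/min_idPr; exact: ler01.
Qed.

Lemma continuous_cutoff M : continuous (cutoff M).
Proof.
move=> x.
apply: (@continuous_min _ _ (cst 1) (fun y => Num.max 0 (M + 1 - `|y|)) x).
  exact: cvg_cst.
apply: (@continuous_max _ _ (cst 0) (fun y => M + 1 - `|y|) x).
  exact: cvg_cst.
by apply: cvgB; [exact: cvg_cst|apply: cvg_norm; exact: cvg_id].
Qed.

Section Probability.
Context d (T : measurableType d) (P : probability T R) (X : T -> R).
Hypothesis mX : measurable_fun setT X.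

Lemma measurable_tail M : measurable [set x | M < `|X x|].
Proof.
rewrite -[X in measurable X]setTI.
have : measurable_fun setT (fun x => M < `|X x|).
  by apply: measurable_fun_ltr => //; exact: measurableT_comp.
by move=> /(_ measurableT [set true]); apply.
Qed.

Lemma integrable_comp_bounded (g : R -> R) (C : R) :
  continuous g -> (forall y, `|g y| <= C) ->
  P.-integrable setT (EFin \o (g \o X)).
Proof.
move=> cg gC; apply: (@bounded_integrable _ _ _ P _ C) => [|x]; last exact: gC.
by apply: measurableT_comp => //; exact: continuous_measurable_fun.
Qed.

(** The difference is the integral of [(g - c) * (1 - cutoff M)] along [X], which vanishes where the
    absolute value of [X] is at most [M] and is bounded by [2 * C] elsewhere. *)
Lemma cutoff_error (g : R -> R) (C c M eps : R) :
  continuous g -> (forall y, `|g y| <= C) -> `|c| <= C ->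
  (P [set x | (M < `|X x|)%R] <= eps%:E)%E ->
  `|\int[P]_x g (X x) - c - \int[P]_x ((g (X x) - c) * cutoff M (X x))|
  <= 2 * C * eps.
Proof.
move=> cg gC cC tail.
have C0 : 0 <= C by apply: le_trans cC.
pose h y := (g y - c) * cutoff M y; pose r y := (g y - c) * (1 - cutoff M y).
have gcC y : `|g y - c| <= 2 * C.
  by rewrite (le_trans (ler_normB _ _))//; have := gC y; lra.
have ch : continuous h.
  move=> y; apply: cvgM; last exact: continuous_cutoff.
  by apply: cvgB; [exact: cg|exact: cvg_cst].
have hC y : `|h y| <= 2 * C.
  rewrite normrM (ger0_norm (cutoff_ge0 _ _)) (le_trans _ (gcC y))//.
  by rewrite ler_piMr// cutoff_le1.
have cr : continuous r.
  move=> y; apply: cvgM; last first.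
    by apply: cvgB; [exact: cvg_cst|exact: continuous_cutoff].
  by apply: cvgB; [exact: cg|exact: cvg_cst].
have r0 y : `|r y| <= 2 * C.
  rewrite normrM (le_trans _ (gcC y))// ler_piMr//.
  by rewrite ger0_norm ?subr_ge0 ?cutoff_le1// gerBl cutoff_ge0.
have ig := integrable_comp_bounded cg gC.
have ih := integrable_comp_bounded ch hC.
have ir := integrable_comp_bounded cr r0.
have ic := finite_measure_integrable_cst P c measurableT.
have -> : \int[P]_x g (X x) - c - \int[P]_x h (X x) = \int[P]_x r (X x).
  (* The constant [c] is written as its integral against the total mass 1, so that linearity
     applies. *)
  rewrite -[X in _ - X - _]mulr1 -[X in _ * X]/(fine 1%:E).
  rewrite -(@probability_setT _ _ _ P) -Rintegral_cst// -!RintegralB//.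
    by apply: eq_Rintegral => x _; rewrite /r /h; ring.
  by apply: (@bounded_integrable _ _ _ P _ (2 * C)); [
    apply: measurable_funB => //; apply: measurableT_comp => //;
    exact: continuous_measurable_fun | move=> x; exact: gcC].
apply: (le_trans (le_normr_Rintegral measurableT ir)).
pose B := [set x | M < `|X x|]; have mB : measurable B by exact: measurable_tail.
apply: (@le_trans _ _ (\int[P]_x (2 * C * \1_B x))).
  apply: le_Rintegral => //.
  - exact: (integrable_norm ir).
  - apply: (@bounded_integrable _ _ _ P _ (2 * C)).
      by apply: measurable_funM => //; exact: measurable_indic.
    move=> x; rewrite normrM ger0_norm ?mulr_ge0// ler_piMr ?mulr_ge0//.
    by rewrite indicE; case: (_ \in _); rewrite ?normr1 ?normr0.
  - move=> x _; rewrite indicE; have [xB|xB] := ltP M `|X x|.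
      by rewrite mem_set// mulr1; exact: r0.
    rewrite [(r \o X) x](_ : _ = 0) ?normr0 ?mulr_ge0//.
    by rewrite /= /r cutoff_eq1 ?subrr ?mulr0.
rewrite RintegralZl//; last first.
  apply: (@bounded_integrable _ _ _ P _ 1) => [|x]; first exact: measurable_indic.
  by rewrite indicE; case: (_ \in _); rewrite ?normr1 ?normr0.
rewrite ler_wpM2l ?mulr_ge0// /Rintegral integral_indic// setIT.
by rewrite -lee_fin fineK// fin_num_measure.
Qed.

(** The tails decrease to the empty set because [X] is real-valued; continuity from above
    concludes. *)
Lemma probability_tight eps : 0 < eps ->
  exists M : R, (P [set x | (M < `|X x|)%R] <= eps%:E)%E.
Proof.
move=> eps0; pose F (n : nat) := [set x | n%:R < `|X x|].
have F0 : \bigcap_n F n = set0.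
  apply/seteqP; split=> // x /(_ (Num.bound `|X x|) I) /=.
  by rewrite /F /= ltNge ltW// archi_boundP.
have : (P \o F) n @[n --> \oo] --> P (\bigcap_n F n).
  apply: nonincreasing_cvg_mu.
  - by rewrite (le_lt_trans (probability_le1 _ _)) ?ltry//; exact: measurable_tail.
  - by move=> n; exact: measurable_tail.
  - by rewrite F0.
  - move=> m n mn; apply/subsetPset => x /=; apply: le_lt_trans.
    by rewrite ler_nat.
rewrite F0 measure0 => /fine_cvgP[_ /cvgrPdist_le/(_ _ eps0)].
move=> [n _ /(_ n (leqnn n))]; rewrite /= sub0r normrN => h; exists n%:R.
have PF : P (F n) \is a fin_num by rewrite fin_num_measure//; exact: measurable_tail.
by rewrite -(fineK PF) lee_fin (le_trans (ler_norm _)).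
Qed.

End Probability.

(* Replacing [f] by [(f - c) * cutoff M], with [c] chosen to make the
   [mu]-integral vanish, reduces convergence in distribution to test functions
   of compact support and zero mean. *)
Lemma cvg_in_distribution_centred d (Omega : measurableType d)
    (P : probability Omega R) (X : nat -> Omega -> R)
    (mu : probability (measurableTypeR R) R) :
  (forall n, measurable_fun setT (X n)) ->
  (forall eps, 0 < eps ->
     exists M, \forall n \near \oo, (P [set x | (M < `|X n x|)%R] <= eps%:E)%E) ->
  (forall (h : R -> R) (A : R), continuous h ->
     (forall x, A < `|x| -> h x = 0) -> (\int[mu]_y (h y)%:E = 0)%E ->
     (\int[P]_x h (X n x)) @[n --> \oo] --> (0 : R)) ->
  cvg_in_distribution P X mu.
Proof.
move=> mX tight hcvg; split=> // f cf [C fC].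
have C0 : 0 <= C by rewrite (le_trans _ (fC 0)).
have mid : measurable_fun setT (id : measurableTypeR R -> R) by exact: measurable_id.
rewrite (_ : (fun n => _) = EFin \o (fun n => \int[P]_x f (X n x))); last first.
  apply/funext => n /=; rewrite fineK// integrable_fin_num//.
  exact: (integrable_comp_bounded P (mX n) cf fC).
have imu g D : continuous g -> (forall y, `|g y| <= D) ->
    mu.-integrable setT (EFin \o g).
  exact: (integrable_comp_bounded mu mid).
rewrite -(fineK (integrable_fin_num measurableT (imu f C cf fC))).
apply: cvg_EFin; first by near=> n.
apply/cvgrPdist_le => eps eps0.
(* The first bound keeps the mass [I1] of the cutoff away from 0; the second makes two cutoff errors
   cost at most [eps / 2], with [C + 1] in place of [C] to avoid a zero denominator. *)
pose e := Num.min 8^-1 (eps / (8 * (C + 1))).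
have C1 : 0 < 8 * (C + 1) by lra.
have e0 : 0 < e by rewrite lt_min invr_gt0 ltr0n divr_gt0.
have e8 : e <= 8^-1 by rewrite ge_min lexx.
have eC : 4 * C * e <= eps / 2.
  have : e <= eps / (8 * (C + 1)) by rewrite ge_min lexx orbT.
  by rewrite ler_pdivlMr//; nra.
have [M1 HM1] := probability_tight mu mid e0.
have [M2 HM2] := tight e e0.
pose M := Num.max M1 M2.
have tail1 : (mu [set x : measurableTypeR R | (M < `|x|)%R] <= e%:E)%E.
  apply: le_trans HM1; apply: le_measure; rewrite ?inE; try exact: measurable_tail.
  by move=> x /=; apply: le_lt_trans; rewrite le_max lexx.
pose psi := cutoff M; pose I1 := \int[mu]_y psi y; pose I2 := \int[mu]_y (f y * psi y).
have psi1 y : `|psi y| <= 1 by rewrite ger0_norm ?cutoff_ge0 ?cutoff_le1.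
have cpsi : continuous psi by exact: continuous_cutoff.
have cfpsi : continuous (fun y => f y * psi y).
  by move=> y; apply: cvgM; [exact: cf|exact: cpsi].
have fpsiC y : `|f y * psi y| <= C.
  by rewrite normrM (le_trans _ (fC y))// ler_piMr.
have ikpsi k : mu.-integrable setT (EFin \o (fun y => k * psi y)).
  apply: (imu _ `|k|) => y; last by rewrite normrM ler_piMr.
  by apply: cvgM; [exact: cvg_cst|exact: cpsi].
have I1_half : 1 / 2 <= I1.
  have int1 : \int[mu]_y (cst 1 y : R) = 1.
    by rewrite Rintegral_cst// mul1r [X in fine X](@probability_setT _ _ _ mu).
  have -> : I1 = \int[mu]_y ((cst 1 y - 0) * cutoff M y).
    by apply: eq_Rintegral => y _; rewrite /= subr0 mul1r.
  have : `|\int[mu]_y (cst 1 y : R) - 0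
           - \int[mu]_y ((cst 1 y - 0) * cutoff M y)| <= 2 * 1 * e.
    apply: cutoff_error => // [y|y|]; first exact: cvg_cst.
      by rewrite /= normr1.
    by rewrite normr0.
  by rewrite int1 ler_norml => /andP[_]; lra.
pose c := I2 / I1.
(* [c] is the average of [f] for the weight [psi], hence obeys the same bound as [f]. *)
have cC : `|c| <= C.
  rewrite normrM normfV ler_pdivrMr; last by rewrite normr_gt0 gt_eqF//; lra.
  rewrite [X in _ <= _ * X]ger0_norm; last by lra.
  rewrite /I1 -RintegralZl//; last exact: imu psi1.
  apply: (le_trans (le_normr_Rintegral measurableT (imu _ _ cfpsi fpsiC))).
  apply: le_Rintegral => //.
  - exact: (integrable_norm (imu _ _ cfpsi fpsiC)).
  - move=> y _; rewrite normrM [X in _ * X]ger0_norm ?cutoff_ge0//.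
    by rewrite ler_wpM2r ?cutoff_ge0.
pose h y := (f y - c) * psi y.
have ch : continuous h.
  move=> y; apply: cvgM; last exact: cpsi.
  by apply: cvgB; [exact: cf|exact: cvg_cst].
have h0 y : M + 1 < `|y| -> h y = 0 by move=> yM; rewrite /h /psi cutoff_eq0// mulr0.
have [D hD] := compact_support_bounded ch h0.
have inth : \int[mu]_y h y = 0.
  transitivity (I2 - c * I1); last by rewrite /c divfK ?subrr// gt_eqF//; lra.
  rewrite /I1 -RintegralZl//; last exact: imu psi1.
  rewrite /I2 -RintegralB//; last exact: imu fpsiC.
  by apply: eq_Rintegral => y _; rewrite /h; ring.
have inthE : (\int[mu]_y (h y)%:E = 0)%E.
  by rewrite -(fineK (integrable_fin_num measurableT (imu h D ch hD))) [fine _]inth.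
have /cvgrPdist_le/(_ (eps / 2)) := hcvg h (M + 1) ch h0 inthE.
rewrite divr_gt0// => /(_ isT) hsmall.
near=> n.
(* Both integrals of [f] are compared with [c]: under [mu] the cutoff part has integral zero, and
   under [P] it is the small integral of [h]. *)
have b1 : `|\int[mu]_y f y - c| <= 2 * C * e.
  have := cutoff_error mid cf fC cC tail1.
  by rewrite [X in _ - X]inth subr0.
have b2 : `|\int[P]_x f (X n x) - c - \int[P]_x h (X n x)| <= 2 * C * e.
  apply: cutoff_error => //.
  have : (P [set x | (M2 < `|X n x|)%R] <= e%:E)%E by near: n.
  apply: le_trans; apply: le_measure; rewrite ?inE; try exact: measurable_tail.
  by move=> x /=; apply: le_lt_trans; rewrite le_max lexx orbT.
have b3 : `|0 - \int[P]_x h (X n x)| <= eps / 2 by near: n; exact: hsmall.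
rewrite sub0r normrN in b3.
change (`|\int[mu]_y f y - \int[P]_x f (X n x)| <= eps).
move: b1 b2 b3 eC; rewrite !ler_norml.
move=> /andP[? ?] /andP[? ?] /andP[? ?] ?.
by apply/andP; split; lra.
Unshelve. all: by end_near.
Qed.

End WeakConvergence.

(** * Law of the first tokens *)

Definition first_tokens (Omega : Type) (T : finType) (v : nat -> Omega -> T)
  (N : nat) (x : Omega) : {ffun 'I_N -> T} := [ffun i : 'I_N => v i x].

Section TokenLaw.
Context (R : realType) d (Omega : measurableType d) (P : probability Omega R).
Variables (T : finType) (v : nat -> Omega -> T) (p : T -> R).
Hypothesis mv : forall n t, measurable (v n @^-1` [set t]).
Hypothesis v_iid : iid_from P v p.

Lemma measurable_first_tokens N t : measurable (first_tokens v N @^-1` [set t]).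
Proof.
rewrite (_ : _ @^-1` _ = \bigcap_(i in [set: 'I_N]) (v i @^-1` [set t i])).
  by apply: fin_bigcap_measurable => // i _; exact: mv.
apply/seteqP; split=> [x /= <- i _|x /= h]; first by rewrite /= ffunE.
by apply/ffunP => i; rewrite ffunE; exact: h.
Qed.

Lemma first_tokens_law N t : P (first_tokens v N @^-1` [set t]) = (weight p t)%:E.
Proof.
have [indep law] := v_iid.
(* Independence is stated for sets indexed by all naturals; positions from [N] on receive the whole
   space as a filler. *)
pose B j := if insub j is Some i then [set (t i : T)] else setT.
have BE (i : 'I_N) : B i = [set t i] by rewrite /B valK.
have -> : first_tokens v N @^-1` [set t] =
    \bigcap_(j in [set` index_iota 0 N]) (v j @^-1` B j).
  apply/seteqP; split=> [x /= xt j /=|x h].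
    rewrite mem_index_iota => /andP[_ jN].
    by rewrite (BE (Ordinal jN)) /= -xt ffunE.
  apply/ffunP => i; rewrite ffunE.
  have := h i; rewrite /= mem_index_iota ltn_ord => /(_ isT).
  by rewrite BE.
rewrite indep ?iota_uniq// big_mkord -prodEFin.
by apply: eq_bigr => i _; rewrite BE law.
Qed.

(** This exhibits a function of the first tokens as a simple function, which gives its measurability
    and its integral. *)
Lemma comp_first_tokensE N (G : {ffun 'I_N -> T} -> R) x :
  G (first_tokens v N x) = \sum_t G t * \1_(first_tokens v N @^-1` [set t]) x.
Proof.
rewrite (bigD1 (first_tokens v N x)) //= indicE mem_set// mulr1 big1 ?addr0// => t tx.
by rewrite indicE memNset ?mulr0//= => xt; rewrite xt eqxx in tx.
Qed.

Lemma measurable_comp_first_tokens N (G : {ffun 'I_N -> T} -> R) :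
  measurable_fun setT (fun x => G (first_tokens v N x)).
Proof.
rewrite (_ : (fun x => _) = fun x =>
    \sum_t G t * \1_(first_tokens v N @^-1` [set t]) x); last first.
  by apply/funext => x; exact: comp_first_tokensE.
apply: measurable_sum => t; apply: measurable_funM => //.
exact/measurable_indic/measurable_first_tokens.
Qed.

Lemma integral_comp_first_tokens N (G : {ffun 'I_N -> T} -> R) :
  (\int[P]_x (G (first_tokens v N x))%:E = (mean p G)%:E)%E.
Proof.
under eq_integral do rewrite comp_first_tokensE -sumEFin.
have ind t : P.-integrable setT
    (fun x => (\1_(first_tokens v N @^-1` [set t]) x : R)%:E).
  apply: (@bounded_integrable _ _ _ P _ 1) => [|x].
    exact/measurable_indic/measurable_first_tokens.
  by rewrite indicE; case: (_ \in _); rewrite ?normr1 ?normr0.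
rewrite integral_sum//; last first.
  by move=> t; under eq_fun do rewrite EFinM; exact: integrableZl.
rewrite /mean -sumEFin; apply: eq_bigr => t _.
under eq_integral do rewrite EFinM.
rewrite integralZl// integral_indic//; last exact: measurable_first_tokens.
by rewrite setIT [X in (_ * X)%E](first_tokens_law t) -EFinM mulrC.
Qed.

Lemma Rintegral_comp_first_tokens N (G : {ffun 'I_N -> T} -> R) :
  \int[P]_x G (first_tokens v N x) = mean p G.
Proof. by rewrite /Rintegral integral_comp_first_tokens. Qed.

Lemma probability_comp_first_tokens N (A : pred {ffun 'I_N -> T}) :
  P [set x | A (first_tokens v N x)] = (mean p (fun t => (A t)%:R))%:E.
Proof.
rewrite -integral_comp_first_tokens.
have -> : [set x | A (first_tokens v N x)] =
    (fun x => (A (first_tokens v N x))%:R : R) @^-1` [set 1].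
  apply/seteqP; split=> x /=; first by move=> ->.
  by case: (A _) => // /eqP; rewrite eq_sym oner_eq0.
set S := _ @^-1` _.
have mS : measurable S.
  rewrite -[S]setTI.
  exact: (measurable_comp_first_tokens (fun t => (A t)%:R)).
rewrite -{1}(setIT S) -(integral_indic P measurableT mS).
apply: eq_integral => x _.
rewrite indicE; have [xS|xS] := boolP (x \in S).
  by move: xS; rewrite inE /S /= => ->.
congr EFin; apply/eqP; rewrite eq_sym; apply/negPn/negP => Ax.
move: xS; rewrite notin_setE /S /=; apply.
by move: Ax; case: (A _) => //; rewrite eqxx.
Qed.

End TokenLaw.

(** * Central limit theorem and Slutsky's lemma *)

Lemma near_sqrt_ge (R : realType) (C : R) :
  \forall N \near \oo, C <= Num.sqrt (N%:R : R).
Proof.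
exists (Num.bound (C ^+ 2)) => // N /= NC.
rewrite (le_trans (ler_norm C))// -sqrtr_sqr ler_wsqrtr//.
rewrite (@le_trans _ _ (Num.bound (C ^+ 2))%:R) ?ler_nat//.
by rewrite ltW// archi_boundP// sqr_ge0.
Qed.

Section Asymptotics.
Variables (R : realType) (T : finType) (p : T -> R).
Hypothesis p_ge0 : forall u, 0 <= p u.
Hypothesis p_sum1 : \sum_u p u = 1.
Local Notation isqrt N := (Num.sqrt (N%:R : R))^-1.

(** The central limit theorem for centred scores, on the test functions to which convergence in
    distribution is reduced. *)
Lemma mean_test_cvg0 (x : T -> R) (h : R -> R) (A : R) :
  \sum_u p u * x u = 0 ->
  continuous h -> (forall y, A < `|y| -> h y = 0) ->
  (\int[centred_normal (second_moment p x)]_y (h y)%:E = 0)%E ->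
  mean p (fun t : {ffun 'I_N -> T} => h (isqrt N * total x t)) @[N --> \oo]
    --> (0 : R).
Proof.
move=> x0 ch hA; rewrite /centred_normal; have [v0|v0] := eqVneq (second_moment p x) 0.
  (* Degenerate case: every string of positive weight has total zero, and the mean zero condition
     under the point mass says [h 0 = 0]. *)
  rewrite integral_dirac//; last first.
    by apply/measurable_EFinP; exact: continuous_measurable_fun.
  rewrite diracT mul1e => -[h0].
  rewrite (_ : (fun N => _) = fun=> 0); first exact: cvg_cst.
  apply/funext => N; apply: big1 => t _.
  have w0 s : 0 <= weight p s * total x s ^+ 2.
    by move=> *; rewrite mulr_ge0 ?weight_ge0 ?sqr_ge0.
  have := mean_total_sqr p_sum1 x0 N; rewrite v0 mulr0 => /eqP.
  rewrite psumr_eq0 => [/allP/(_ t)|s _]; last exact: w0.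
  rewrite mem_index_enum mulf_eq0 sqrf_eq0 => /(_ isT)/orP[/eqP ->|/eqP ->].
    by rewrite mul0r.
  by rewrite mulr0 h0 mulr0.
have vgt0 : 0 < second_moment p x by rewrite lt_neqAle eq_sym v0 second_moment_ge0.
have s0 : Num.sqrt (second_moment p x) != 0 by rewrite gt_eqF// sqrtr_gt0.
move=> inth; have [f [g [fg cg g0 hfg]]] := stein_equation s0 ch hA inth.
rewrite sqr_sqrtr ?ltW// in hfg.
apply/cvgrPdist_le => eps eps0.
have [delta delta0 gmod] := compact_support_unif_continuous cg g0 eps0.
pose M := \sum_u `|x u|.
have xM u : `|x u| <= M by rewrite /M (bigD1 u)//= lerDl sumr_ge0.
near=> N.
have N0 : 0 < Num.sqrt (N%:R : R).
  by apply: (@lt_le_trans _ _ 1) => //; near: N; exact: near_sqrt_ge.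
have kN : isqrt N ^+ 2 * N%:R = 1.
  by rewrite exprVn sqr_sqrtr// mulVf// gt_eqF// -sqrtr_gt0.
have kM : 2 * isqrt N * M <= delta.
  rewrite mulrAC ler_pdivrMr// -ler_pdivrMl//.
  by near: N; exact: near_sqrt_ge.
have k0 : 0 <= isqrt N by rewrite invr_ge0 ltW.
have := stein_bound p_ge0 p_sum1 x0 fg gmod xM k0 kN kM.
(* By Stein's equation the quantity bounded by [stein_bound] is the variance times the mean of [h],
   up to sign; the positive variance then cancels on both sides. *)
rewrite -meanZ -meanB.
rewrite (eq_mean p (G := fun t => - second_moment p x * h (isqrt N * total x t))).
  rewrite meanZ normrM normrN (gtr0_norm vgt0) (ler_pM2l vgt0).
  by rewrite sub0r normrN.
by move=> t; rewrite mulNr hfg opprB.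
Unshelve. all: by end_near.
Qed.

Section Slutsky.
Variables z w q : forall N, {ffun 'I_N -> T} -> R.
Variables K L V : R.
Hypothesis K0 : 0 <= K.
Hypothesis L0 : 0 <= L.
Hypothesis q_ge0 : forall N t, 0 <= @q N t.
(** [z] is the statistic of interest, [w] its linear part and [q] a nonnegative error of small mean.
    The second alternative describes an exceptional event whose probability is controlled by
    Markov's inequality. *)
Hypothesis close : forall N (t : {ffun 'I_N -> T}), (0 < N)%N ->
  `|z t - w t| <= K * q t \/ 1 <= L * q t.
Hypothesis mean_q : forall N, mean p (@q N) <= V / Num.sqrt N%:R.

(** Where [z] and [w] are within [delta], uniform continuity suffices. Elsewhere either alternative
    of [close] gives [1 <= (L + K / delta) * q t], so the crude bound [2 * H] is absorbed by a
    multiple of [q]. *)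
Lemma slutsky_test_cvg0 (h : R -> R) (A : R) :
  continuous h -> (forall y, A < `|y| -> h y = 0) ->
  mean p (fun t : {ffun 'I_N -> T} => h (w t)) @[N --> \oo] --> (0 : R) ->
  mean p (fun t : {ffun 'I_N -> T} => h (z t)) @[N --> \oo] --> (0 : R).
Proof.
move=> ch hA /cvgrPdist_le hw; apply/cvgrPdist_le => eps eps0.
have e3 : 0 < eps / 3 by rewrite divr_gt0.
have [H hH] := compact_support_bounded ch hA.
have H0 : 0 <= H by rewrite (le_trans _ (hH 0)).
have [delta delta0 hmod] := compact_support_unif_continuous ch hA e3.
pose C := 2 * H * (L + K / delta).
have C0 : 0 <= C by rewrite mulr_ge0 ?mulr_ge0// addr_ge0// divr_ge0// ltW.
have step N (t : {ffun 'I_N -> T}) : (0 < N)%N ->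
    `|h (z t) - h (w t)| <= eps / 3 + C * q t.
  move=> N0; have q0 := q_ge0 t.
  have [small|big] := leP `|z t - w t| delta.
    by rewrite (le_trans (hmod _ _ small))// lerDl mulr_ge0.
  have one : 1 <= (L + K / delta) * q t.
    case: (close t N0) => [zw|Lq]; rewrite mulrDl.
      suff : 1 <= K / delta * q t by have := mulr_ge0 L0 q0; lra.
      by rewrite mulrAC ler_pdivlMr// mul1r (le_trans (ltW big)).
    by have := mulr_ge0 (divr_ge0 K0 (ltW delta0)) q0; lra.
  rewrite (le_trans (ler_normB _ _))// /C -mulrA.
  have := ler_wpM2l (mulr_ge0 (ltac:(by []) : 0 <= 2 :> R) H0) one.
  by have := hH (z t); have := hH (w t); lra.
near=> N.
have N0 : 0 < Num.sqrt (N%:R : R).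
  by apply: (@lt_le_trans _ _ 1) => //; near: N; exact: near_sqrt_ge.
have Npos : (0 < N)%N by rewrite -(ltr0n R) -sqrtr_gt0.
have CV : C * (V / Num.sqrt N%:R) <= eps / 3.
  rewrite mulrA ler_pdivrMr// -ler_pdivrMl//.
  by near: N; exact: near_sqrt_ge.
have b1 : `|mean p (fun t : {ffun 'I_N -> T} => h (w t))| <= eps / 3.
  by rewrite -normrN -sub0r; near: N; exact: hw.
have b2 : `|mean p (fun t : {ffun 'I_N -> T} => h (z t)) -
            mean p (fun t : {ffun 'I_N -> T} => h (w t))| <= 2 * (eps / 3).
  rewrite -meanB (le_trans (ler_norm_mean p_ge0 _))//.
  apply: (le_trans (le_mean p_ge0 (fun t => step N t Npos))).
  rewrite meanD mean_cst// meanZ.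
  by have := ler_wpM2l C0 (mean_q N); lra.
rewrite sub0r normrN; move: b1 b2; rewrite !ler_norml.
by move=> /andP[? ?] /andP[? ?]; apply/andP; split; lra.
Unshelve. all: by end_near.
Qed.

Lemma slutsky_tight (B : R) :
  (forall N, (0 < N)%N -> mean p (fun t : {ffun 'I_N -> T} => w t ^+ 2) <= B) ->
  forall eps : R, 0 < eps -> exists M : R, \forall N \near \oo,
    mean p (fun t : {ffun 'I_N -> T} => ((M < `|z t|)%R)%:R : R) <= eps.
Proof.
move=> wB eps eps0; have e2 : 0 < eps / 2 by rewrite divr_gt0.
(* A value of [z] above [2 * m] forces [w] above [m] or a gap of at least 1. As [m] is at least 1, a
   [w] above [m] has square at least [m], and [2 * B / eps] makes [B / m] at most [eps / 2]. *)
pose m := Num.max 1 (2 * B / eps).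
have m1 : 1 <= m by rewrite le_max lexx.
have m0 : 0 < m by exact: lt_le_trans m1.
exists (2 * m); near=> N.
have N0 : 0 < Num.sqrt (N%:R : R).
  by apply: (@lt_le_trans _ _ 1) => //; near: N; exact: near_sqrt_ge.
have Npos : (0 < N)%N by rewrite -(ltr0n R) -sqrtr_gt0.
have CV : (K + L) * (V / Num.sqrt N%:R) <= eps / 2.
  rewrite mulrA ler_pdivrMr// -ler_pdivrMl//.
  by near: N; exact: near_sqrt_ge.
have step (t : {ffun 'I_N -> T}) :
    ((2 * m < `|z t|)%R)%:R <= m^-1 * w t ^+ 2 + (K + L) * q t.
  have q0 := q_ge0 t; have Kq := mulr_ge0 K0 q0; have Lq := mulr_ge0 L0 q0.
  have mw : 0 <= m^-1 * w t ^+ 2 by rewrite mulr_ge0 ?sqr_ge0// invr_ge0 ltW.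
  have [zm|_] := ltP (2 * m) `|z t|; last by rewrite /=; lra.
  have [wm|wm] := ltP m `|w t|.
    suff : 1 <= m^-1 * w t ^+ 2 by rewrite /=; lra.
    rewrite mulrC ler_pdivlMr// mul1r -real_normK ?num_real//; nra.
  have zw : 1 <= `|z t - w t|.
    by have := lerB_dist (z t) (w t); lra.
  by case: (close t Npos) => h; rewrite /=; lra.
apply: (le_trans (le_mean p_ge0 step)); rewrite meanD !meanZ.
have b1 : m^-1 * mean p (fun t : {ffun 'I_N -> T} => w t ^+ 2) <= eps / 2.
  rewrite mulrC ler_pdivrMr// (le_trans (wB N Npos))//.
  have : 2 * B / eps <= m by rewrite le_max lexx orbT.
  by rewrite ler_pdivrMr//; lra.
by have := ler_wpM2l (addr_ge0 K0 L0) (mean_q N); lra.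
Unshelve. all: by end_near.
Qed.

End Slutsky.
End Asymptotics.

(** * Readability scores *)

Lemma bounded_in_probability_near (R : realType) d (Omega : measurableType d)
    (P : probability Omega R) (X : nat -> Omega -> R) :
  (forall n, measurable_fun setT (X n)) ->
  (forall eps : R, 0 < eps -> exists M : R,
     \forall n \near \oo, (P [set x | (M < `|X n x|)%R] <= eps%:E)%E) ->
  bounded_in_probability P X.
Proof.
move=> mX tight; split=> // eps eps0.
have [M [N _ HM]] := tight eps eps0.
have /boolp.choice[f Hf] : forall n, exists M : R,
    (P [set x | (M < `|X n x|)%R] <= eps%:E)%E.
  by move=> n; exact: probability_tight.
(* Each of the finitely many early variables is tight by itself; this sum dominates [M] and all
   their bounds. *)
exists (`|M| + \sum_(n < N) `|f n|) => n.
have sum0 : 0 <= \sum_(n < N) `|f n| by apply: sumr_ge0.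
have mono (C D : R) : C <= D -> (P [set x | (C < `|X n x|)%R] <= eps%:E)%E ->
    (P [set x | (D < `|X n x|)%R] <= eps%:E)%E.
  move=> CD; apply: le_trans; apply: le_measure; rewrite ?inE;
    try exact: measurable_tail.
  by move=> x /=; exact: le_lt_trans.
have [nN|Nn] := ltnP n N; last first.
  by apply: (mono M); [have := ler_norm M; lra|exact: HM].
apply: mono (Hf n); rewrite (bigD1 (Ordinal nN)) //=.
have : 0 <= \sum_(i < N | i != Ordinal nN) `|f i| by apply: sumr_ge0.
by have := ler_norm (f n); have := normr_ge0 M; lra.
Qed.

(** The remainder is an exact combination of [d1 ^+ 2] and [d1 * d2] with denominators [e + d1] and
    [1 - (e + d1)]. Taking [r] as half of the smaller of [e] and [1 - e] keeps these at least
    [e / 2] and [(1 - e) / 2], whence the factors 2 in [K]. *)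
Lemma readability_linearization (R : realType) (a b e s : R) : 0 < e < 1 ->
  exists r K : R, [/\ 0 < r, 0 <= K & forall d1 d2, `|d1| <= r ->
    0 < e + d1 < 1 /\
    `|a * ((1 - (e + d1)) / (e + d1)) + b * ((s + d2) / (1 - (e + d1)))
      - (a * ((1 - e) / e) + b * (s / (1 - e)))
      - ((- (a / e ^+ 2) + b * s / (1 - e) ^+ 2) * d1 + b / (1 - e) * d2)|
    <= K * (d1 ^+ 2 + d2 ^+ 2)].
Proof.
move=> /andP[e0 e1]; have e10 : 0 < 1 - e by lra.
pose c1 := a / e ^+ 2; pose c2 := b / (1 - e); pose c3 := b * s / (1 - e) ^+ 2.
pose K := `|c1| * (2 / e) + `|c2| * (2 / (1 - e)) + `|c3| * (2 / (1 - e)).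
exists (Num.min e (1 - e) / 2), K; split.
- by rewrite divr_gt0// lt_min e0.
- by rewrite !addr_ge0// mulr_ge0// divr_ge0// ltW.
move=> d1 d2; rewrite ler_pdivlMr// le_min => /andP[d1e d1e1].
have [h1 h2] : - d1 <= `|d1| /\ d1 <= `|d1|.
  by rewrite ler_norm -normrN ler_norm.
have pos : 0 < e + d1 by lra.
have pos1 : 0 < 1 - (e + d1) by lra.
split; first by apply/andP; split; lra.
have i1 : (e + d1)^-1 <= 2 / e.
  by rewrite ler_pdivlMr// mulrC ler_pdivrMr//; lra.
have i2 : (1 - (e + d1))^-1 <= 2 / (1 - e).
  by rewrite ler_pdivlMr// mulrC ler_pdivrMr//; lra.
have bound (x k u U : R) : `|x| <= d1 ^+ 2 + d2 ^+ 2 -> 0 < u -> u^-1 <= U ->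
    `|k * u^-1 * x| <= `|k| * U * (d1 ^+ 2 + d2 ^+ 2).
  move=> xD u0 uU; rewrite !normrM normfV (gtr0_norm u0).
  apply: ler_pM => //; first by rewrite mulr_ge0// invr_ge0 ltW.
  by rewrite ler_wpM2l.
have sq : `|d1 ^+ 2| <= d1 ^+ 2 + d2 ^+ 2.
  by rewrite ger0_norm ?sqr_ge0// lerDl sqr_ge0.
have cross : `|d1 * d2| <= d1 ^+ 2 + d2 ^+ 2.
  by rewrite ler_norml; apply/andP; split; nra.
rewrite [X in `|X|](_ : _ = c1 * (e + d1)^-1 * d1 ^+ 2
    + c2 * (1 - (e + d1))^-1 * (d1 * d2)
    + c3 * (1 - (e + d1))^-1 * d1 ^+ 2); last first.
  rewrite /c1 /c2 /c3; field.
  by rewrite !gt_eqF//; lra.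
rewrite (le_trans (ler_normD _ _))// (le_trans (lerD (ler_normD _ _) (lexx _)))//.
have := bound _ c1 _ _ sq pos i1; have := bound _ c2 _ _ cross pos1 i2.
by have := bound _ c3 _ _ sq pos1 i2; rewrite /K; lra.
Qed.

Lemma big_option_sum (R : nmodType) (V : finType) (F : option V -> R) :
  \sum_u F u = F None + \sum_w F (Some w).
Proof.
rewrite (bigD1 None) //=; congr (_ + _).
rewrite (reindex_omap Some id) /=; last by case.
by apply: eq_bigl => w; rewrite eqxx.
Qed.

Section Readability.
Variables (R : realType) (V : finType) (a b c : R) (syl : V -> R) (dflt : R).
Variable p : option V -> R.
Hypothesis p_ge0 : forall u, 0 <= p u.
Hypothesis p_sum1 : \sum_u p u = 1.
Hypothesis e01 : 0 < eos p < 1.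

Definition eos_dev (u : option V) : R := (u == None)%:R - eos p.
Definition syl_dev (u : option V) : R := syl_ext syl u - sigma syl p.
(** The differential of [Phi] at the true boundary probability and mean syllable count, applied to
    the deviation of one token. *)
Definition score (u : option V) : R :=
  g_e a b syl p * eos_dev u + g_sigma b p * syl_dev u.

Lemma sum_words : \sum_w p (Some w) = 1 - eos p.
Proof. by rewrite -p_sum1 big_option_sum /eos; ring. Qed.

Lemma eos_dev_centred : \sum_u p u * eos_dev u = 0.
Proof.
rewrite big_option_sum /eos_dev /=.
under eq_bigr do rewrite sub0r.
by rewrite -mulr_suml sum_words /eos; ring.
Qed.

Lemma syl_dev_centred : \sum_u p u * syl_dev u = 0.
Proof.
rewrite big_option_sum /syl_dev /=.
under eq_bigr do rewrite mulrBr.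
by rewrite sumrB -mulr_suml sum_words -/(sigma syl p) /eos; ring.
Qed.

Lemma score_centred : \sum_u p u * score u = 0.
Proof.
rewrite /score; under eq_bigr do rewrite mulrDr !(mulrCA (p _)).
by rewrite big_split /= -!mulr_sumr eos_dev_centred syl_dev_centred !mulr0 addr0.
Qed.

Lemma second_moment_score : second_moment p score = tau2 a b syl p.
Proof.
rewrite /second_moment big_option_sum /score /eos_dev /syl_dev /=.
set ge := g_e _ _ _ _; set gs := g_sigma _ _; set e := eos p; set s := sigma _ _.
(* [A] is the part of a word's score that does not depend on the word. *)
pose A := - (ge * e) - gs * s.
under eq_bigr => w _.
  rewrite (_ : p (Some w) * _ = A ^+ 2 * p (Some w) + 2 * A * gs * (p (Some w) * syl w)
    + gs ^+ 2 * (p (Some w) * syl w ^+ 2)); last by rewrite /A; ring.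
  over.
rewrite !big_split /= -!mulr_sumr sum_words -/(sigma syl p) -/(sigma2 syl p).
by rewrite /tau2 /A -/ge -/gs -/e -/s -/(eos p) -/e; ring.
Qed.

(* Lets [FKGL] be evaluated on a finite string of [N] tokens. *)
Definition letters N (n : nat) (t : {ffun 'I_N -> option V}) : option V :=
  if insub n is Some i then t i else None.

Lemma lettersE N (t : {ffun 'I_N -> option V}) (i : 'I_N) : letters i t = t i.
Proof. by rewrite /letters valK. Qed.

Lemma FKGL_first_tokens (Omega : Type) (v : nat -> Omega -> option V) N x :
  FKGL v a b c syl dflt N x =
  FKGL (@letters N) a b c syl dflt N (first_tokens v N x).
Proof.
have E (i : 'I_N) : letters i (first_tokens v N x) = v i x by rewrite lettersE ffunE.
have Es : sentences v N x = sentences (@letters N) N (first_tokens v N x).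
  by apply: eq_bigr => i _; rewrite E.
have Ey : syllables v syl N x = syllables (@letters N) syl N (first_tokens v N x).
  by apply: eq_bigr => i _; rewrite E.
by rewrite /FKGL /words Es Ey.
Qed.

Definition fkgl_error N (t : {ffun 'I_N -> option V}) : R :=
  Num.sqrt N%:R * (FKGL (@letters N) a b c syl dflt N t - Phi a b c syl p).

Definition sqr_error N (t : {ffun 'I_N -> option V}) : R :=
  Num.sqrt N%:R * ((total eos_dev t / N%:R) ^+ 2 + (total syl_dev t / N%:R) ^+ 2).

Lemma sqr_error_ge0 N t : 0 <= @sqr_error N t.
Proof. by rewrite mulr_ge0 ?sqrtr_ge0// addr_ge0 ?sqr_ge0. Qed.

(** Squared totals have mean of order [N], so dividing by [N] squared and multiplying by the square
    root leaves the stated rate. For [N = 0] both sides are 0, since the inverse of 0 is 0. *)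
Lemma mean_sqr_error N : mean p (@sqr_error N) <=
  (second_moment p eos_dev + second_moment p syl_dev) / Num.sqrt N%:R.
Proof.
rewrite (eq_mean p (G := fun t => (Num.sqrt N%:R * N%:R ^- 2) *
  (total eos_dev t ^+ 2 + total syl_dev t ^+ 2))); last first.
  by move=> t; rewrite /sqr_error !expr_div_n; ring.
rewrite meanZ meanD !mean_total_sqr// ?eos_dev_centred ?syl_dev_centred//.
case: N => [|N]; first by rewrite sqrtr0 !mul0r invr0 mulr0.
set k := Num.sqrt _; have k0 : k != 0 by rewrite gt_eqF// sqrtr_gt0.
have -> : N.+1%:R = k ^+ 2 by rewrite sqr_sqrtr.
by rewrite le_eqVlt; apply/orP; left; apply/eqP; field.
Qed.

Lemma mean_score_sqr N : (0 < N)%N ->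
  mean p (fun t : {ffun 'I_N -> option V} =>
    ((Num.sqrt N%:R)^-1 * total score t) ^+ 2) <= second_moment p score.
Proof.
move=> N0; under eq_mean do rewrite exprMn.
rewrite meanZ mean_total_sqr ?score_centred// exprVn sqr_sqrtr//.
by rewrite mulKf// pnatr_eq0 -lt0n.
Qed.

(** If the boundary frequency deviates by at most [r], the linearization applies and is scaled by
    the square root of [N]. Otherwise the squared deviation exceeds [r ^+ 2], and [L = r ^- 2] gives
    the second alternative because that root is at least 1. *)
Lemma fkgl_error_linearization : exists K L : R, [/\ 0 <= K, 0 <= L &
  forall N (t : {ffun 'I_N -> option V}), (0 < N)%N ->
  `|fkgl_error t - (Num.sqrt N%:R)^-1 * total score t| <= K * sqr_error t \/
  1 <= L * sqr_error t].
Proof.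
have [r [K [r0 K0 lin]]] := readability_linearization a b (sigma syl p) e01.
exists K, (r ^- 2); split=> // [|N t N0]; first by rewrite invr_ge0 sqr_ge0.
pose d1 := total eos_dev t / N%:R; pose d2 := total syl_dev t / N%:R.
have n0 : (N%:R : R) != 0 by rewrite pnatr_eq0 -lt0n.
have kN : Num.sqrt N%:R ^+ 2 = N%:R :> R by rewrite sqr_sqrtr.
have k1 : 1 <= Num.sqrt N%:R :> R.
  by rewrite -[leLHS]sqrtr1 ler_wsqrtr// ler1n.
have k0 : Num.sqrt N%:R != 0 :> R by rewrite gt_eqF// (lt_le_trans _ k1).
have [d1r|d1r] := leP `|d1| r; last first.
  right; rewrite mulrC ler_pdivlMr ?exprn_gt0// mul1r /sqr_error -/d1 -/d2.
  have : r ^+ 2 <= d1 ^+ 2 by rewrite -[leRHS]real_normK ?num_real//; nra.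
  by have := sqr_ge0 d2; have := sqr_ge0 d1; nra.
left; have [/andP[p1 p2] main] := lin d1 d2 d1r.
pose S := sentences (@letters N) N t; pose Y := syllables (@letters N) syl N t.
have SN : (S <= N)%N.
  by rewrite /S /sentences -[leqRHS]card_ord -sum1_card leq_sum// => i _; case: eqP.
have d1E : eos p + d1 = S%:R / N%:R.
  rewrite /d1 /total sumrB sumr_const card_ord -[eos p *+ N]mulr_natl.
  rewrite /S /sentences natr_sum mulrBl mulrAC divff// mul1r addrC subrK.
  by congr (_ / _); apply: eq_bigr => i _; rewrite lettersE.
have d2E : sigma syl p + d2 = Y / N%:R.
  rewrite /d2 /total sumrB sumr_const card_ord -[sigma syl p *+ N]mulr_natl.
  rewrite mulrBl mulrAC divff// mul1r addrC subrK.
  by congr (_ / _); apply: eq_bigr => i _; rewrite lettersE.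
have NS : (N - S)%:R = N%:R - S%:R :> R by rewrite natrB.
rewrite d1E in p1 p2 main; rewrite d2E in main.
have npos : 0 < N%:R :> R by rewrite ltr0n.
have S0 : S%:R != 0 :> R.
  by apply/eqP => S0; move: p1; rewrite S0 mul0r ltxx.
have W0 : N%:R - S%:R != 0 :> R.
  rewrite subr_eq0; apply/eqP => S0'; move: p2.
  by rewrite -S0' divff// ltxx.
have FE : FKGL (@letters N) a b c syl dflt N t =
    a * ((1 - S%:R / N%:R) / (S%:R / N%:R)) +
    b * (Y / N%:R / (1 - S%:R / N%:R)) + c.
  (* The default value is excluded here: [p1] and [p2] place the sentence count strictly between 0
     and [N]. *)
  rewrite /FKGL /words -/S -/Y ifF; last first.
    by apply/negbTE; rewrite negb_or -!(pnatr_eq0 R) NS S0 W0.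
  by rewrite NS; congr (_ + _); field; rewrite n0 S0 W0.
have tE : total score t = N%:R * (g_e a b syl p * d1 + g_sigma b p * d2).
  rewrite /total /score big_split -!mulr_sumr -/(total eos_dev t) -/(total syl_dev t).
  by rewrite /d1 /d2 /=; field.
rewrite /fkgl_error /sqr_error tE FE /Phi -/d1 -/d2.
rewrite [X in `|X|](_ : _ = Num.sqrt N%:R * (a * ((1 - S%:R / N%:R) / (S%:R / N%:R)) +
    b * (Y / N%:R / (1 - S%:R / N%:R))
    - (a * ((1 - eos p) / eos p) + b * (sigma syl p / (1 - eos p)))
    - (g_e a b syl p * d1 + g_sigma b p * d2))); last first.
  have -> : (Num.sqrt N%:R)^-1 * (N%:R * (g_e a b syl p * d1 + g_sigma b p * d2))
      = Num.sqrt N%:R * (g_e a b syl p * d1 + g_sigma b p * d2).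
    by rewrite -[X in _ * (X * _)]kN expr2 -mulrA mulKf.
  by ring.
rewrite normrM (ger0_norm (sqrtr_ge0 _)) [leRHS]mulrCA.
exact: (ler_wpM2l (sqrtr_ge0 _) main).
Qed.

End Readability.

Theorem theorem10 (R : realType) (V : finType) (K : nat)
    (d : measure_display) (Omega : measurableType d)
    (a b c : R) (syl : V -> R) (smax dflt : R)
    (M : topic_model R V K Omega) (theta : K.-tuple R) :
  readability_coefficients a b c ->
  (forall w : V, 1 <= syl w <= smax) ->
  simplex (tnth theta) ->
  0 < eos (token_prob M theta) < 1 ->
  let pi_theta := token_prob M theta in
  let P := doc_law M theta in
  let Z := fun (N : nat) (x : Omega) =>
    Num.sqrt (N%:R : R) *
    (FKGL (token M) a b c syl dflt N x - Phi a b c syl pi_theta) in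
  cvg_in_distribution P Z (centred_normal (tau2 a b syl pi_theta)) /\
  bounded_in_probability P Z.
Proof.
move=> _ _ simp e01 p P Z.
have [p_ge0 p_sum1] := token_prob_simplex M simp.
have iid := token_iid M simp.
have mtok := measurable_token M.
pose z N := @fkgl_error R V a b c syl dflt p N.
have ZE N x : Z N x = z N (first_tokens (token M) N x).
  by rewrite /Z /z /fkgl_error FKGL_first_tokens.
have mZ N : measurable_fun setT (Z N).
  rewrite (_ : Z N = fun x => z N (first_tokens (token M) N x)).
    exact: measurable_comp_first_tokens.
  by apply/funext => x; exact: ZE.
have [K1 [L [K0 L0 close]]] := fkgl_error_linearization a b c syl dflt e01.
(* Eventual tightness serves twice: it gives boundedness in probability, and it permits compactly
   supported test functions. *)
have tight eps : 0 < eps -> exists B : R,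
    \forall n \near \oo, (P [set x | (B < `|Z n x|)%R] <= eps%:E)%E.
  move=> eps0.
  have [B HB] := slutsky_tight p_ge0 K0 L0 (sqr_error_ge0 syl p) close
    (mean_sqr_error syl p_sum1)
    (mean_score_sqr a b syl p_sum1) eps0.
  exists B; apply: filterS HB => N; rewrite -lee_fin; apply: le_trans.
  rewrite -(probability_comp_first_tokens mtok iid (fun t => B < `|z N t|)).
  by under eq_set do rewrite ZE.
split; last exact: bounded_in_probability_near.
apply: cvg_in_distribution_centred => // h A ch hA inth.
rewrite (_ : (fun N => _) = fun N => mean p (fun t => h (z N t))); last first.
  apply/funext => N; under eq_Rintegral do rewrite ZE.
  exact: (Rintegral_comp_first_tokens mtok iid (fun t => h (z N t))).
apply: (slutsky_test_cvg0 p_ge0 p_sum1 K0 L0 (sqr_error_ge0 syl p) close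
  (mean_sqr_error syl p_sum1) ch hA).
(* The limit variance is recognised as the second moment of the score, the form used by the central
   limit theorem. *)
rewrite -(second_moment_score a b syl p_sum1) in inth.
exact: (mean_test_cvg0 p_ge0 p_sum1 (score_centred a b syl p_sum1) ch hA inth).
Qed.
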